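(* Let $\Omega$ be an indexing set of separable kernels and let $F_0\in\mathfrak{E}(\Omega)$ be any vertex-edge decorated rooted forest. The Reduction Algorithm (described in the context), run on input $F_0$, terminates after finitely many steps. The output forest $F'\in\mathfrak{E}(\Omega)$ contains no branching points and is equivalent to the input forest $F_0$.
   Context: **Kernels and operators.** $C(\mathbb{R})$ is the set of continuous functions $\mathbb{R}\to\mathbb{R}$. $\Omega$ is an indexing set; for each $\omega\in\Omega$ there is a separable kernel $K_\omega(x,t)=k_\omega(x)h_\omega(t)$ with $k_\omega,h_\omega\in C(\mathbb{R})$ and $k_\omega(x)\neq 0$ for all $x$. Put $\tau_\omega(x)=k_\omega(x)/k_\omega(0)$, an element of $C(\mathbb{R})$ with pointwise inverse $\tau_\omega^{-1}=1/\tau_\omega\in C(\mathbb{R})$. The Volterra integral operator $P_\omega:C(\mathbb{R})\to C(\mathbb{R})$ is $P_\omega(f)(x)=\int_0^x K_\omega(x,t)f(t)\,dt$. **Trees and forests.** A rooted tree is a finite tree with a distinguished root vertex. The height of a vertex is the number of edges on the path from it to the root. The parent of a non-root vertex $v$ is the vertex adjacent to $v$ on the path from $v$ to the root; $v$ is then a child of its parent. A leaf is a non-root vertex with no children. A branching point is a vertex with at least two children. A descendant of $v$ is a vertex $w\ne v$ whose path to the root contains $v$. A chain is a subtree without branching points. For a vertex $v$ of a tree $T$, $T(v)$ is the subtree, rooted at $v$, consisting of $v$ and all its descendants, and $B(v)$ is the subtree consisting of all vertices of $T$ except the descendants of $v$. A vertex-edge decorated rooted tree is a rooted tree whose vertices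 are labelled by (possibly unknown) elements of $C(\mathbb{R})$ and whose edges are labelled by elements of $\Omega$. ''Possibly unknown'' means that labels may involve unknown functions, and become actual elements of $C(\mathbb{R})$ once values in $C(\mathbb{R})$ are assigned to the unknowns. $\mathcal{E}(\Omega)$ is the set of such trees, and $\mathfrak{E}(\Omega)$ is the set of (finite) formal sums of elements of $\mathcal{E}(\Omega)$, called forests. **Integral polynomial of a forest.** To a tree with root label $a$, whose root has children $v_1,\dots,v_m$ joined to it by edges labelled $\omega_1,\dots,\omega_m$, one recursively associates $$p_T=a\prod_{i=1}^m P_{\omega_i}\bigl(p_{T(v_i)}\bigr)$$ (so $p_T=a$ if there are no children). To a forest $F=\sum_j T_j$ one associates $p_F=\sum_j p_{T_j}$. Two forests $F,F'$ are equivalent if the integral equations $p_F=0$ and $p_{F'}=0$ (in the unknown functions occurring in the labels) have the same solution set. **Reduction Algorithm.** Input: a forest $F_0\in\mathfrak{E}(\Omega)$. If no tree in the current forest has a branching point, stop and output the current forest $F'$. Otherwise: 1. Pick any tree $T$ in the forest that has a branching point, and pick any branching point of $T$ of maximum height among the branching points of $T$; write $x$ both for this vertex and for its label. Then $x$ has $m\ge 2$ children, and for $1\le i\le m$ the subtree at the $i$-th child is a chain with vertex labels (from bottom to top) $f_{i,1},f_{i,2},\dots,f_{i,n_i}$, where the edge from $x$ to $f_{i,1}$ is labelled $\alpha_{i,1}$ and the edge from $f_{i,j-1}$ to $f_{i,j}$ is labelled $\alpha_{i,j}$ ($2\le j\le n_i$). Let $T(f_{i,j})$ denote the chain from $f_{i,j}$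 up to $f_{i,n_i}$. 2. Form two trees $T_1',T_2'$ from $T(x)$: - $T_1'$ has root label $\tau_{\alpha_{2,1}}x$. The root is joined by an edge labelled $\alpha_{1,1}$ to a vertex labelled $\tau_{\alpha_{2,1}}^{-1}f_{1,1}$, and by edges labelled $\alpha_{i,1}$ to the roots of the chains $T(f_{i,1})$ for $3\le i\le m$. The vertex labelled $\tau_{\alpha_{2,1}}^{-1}f_{1,1}$ is joined to the root of $T(f_{1,2})$ by an edge labelled $\alpha_{1,2}$ (if $n_1>1$) and to the root of $T(f_{2,1})$ by an edge labelled $\alpha_{2,1}$. - $T_2'$ has root label $\tau_{\alpha_{1,1}}x$. The root is joined by an edge labelled $\alpha_{2,1}$ to a vertex labelled $\tau_{\alpha_{1,1}}^{-1}f_{2,1}$, and by edges labelled $\alpha_{i,1}$ to the roots of the chains $T(f_{i,1})$ for $3\le i\le m$. The vertex labelled $\tau_{\alpha_{1,1}}^{-1}f_{2,1}$ is joined to the root of $T(f_{1,1})$ by an edge labelled $\alpha_{1,1}$ and to the root of $T(f_{2,2})$ by an edge labelled $\alpha_{2,2}$ (if $n_2>1$). 3. For $i=1,2$ let $T_i$ be the tree obtained from $T$ by replacing the subtree $T(x)$ by $T_i'$ (i.e. $B(x)$ with $T_i'$ attached in place of $T(x)$, the root of $T_i'$ taking the place of $x$). Remove $T$ from the forest and add $T_1$ and $T_2$ in its place. 4. If there are no branching points in any tree of the forest, stop and output it as $F'$; otherwise return to step 1. *)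

(* Defs.v *)
From Stdlib Require Import Reals Lra List Permutation.
From Coquelicot Require Import Coquelicot.
Import ListNotations.
Set Implicit Arguments.
Open Scope R_scope.

Record CR := mkCR {
  CR_fun :> R -> R;
  CR_cont : forall x, continuous CR_fun x
}.

Definition CR_const (c : R) : CR := mkCR (fun x => continuous_const c x).

Definition CR_add (f g : CR) : CR :=
  mkCR (fun x => continuous_plus f g x (CR_cont f x) (CR_cont g x)).

Definition CR_mul (f g : CR) : CR :=
  mkCR (fun x => continuous_mult f g x (CR_cont f x) (CR_cont g x)).

Definition CR_inv (f : CR) (f_neq0 : forall x, f x <> 0) : CR :=
  mkCR (fun x => continuous_Rinv_comp f x (CR_cont f x) (f_neq0 x)).

Record separable_kernel := mkKernel {
  ker_k : CR;
  ker_h : CR;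
  ker_k_neq0 : forall x, ker_k x <> 0
}.

Definition kernel (K : separable_kernel) (x t : R) : R :=
  ker_k K x * ker_h K t.

Lemma volterra_continuous (K : separable_kernel) (f : CR) (x : R) :
  continuous (fun x => RInt (fun t => kernel K x t * f t) 0 x) x.
Proof.
set (g := CR_mul (ker_h K) f).
assert (Hg : forall a b, ex_RInt g a b).
{ intros a b. apply (ex_RInt_continuous (V := R_CompleteNormedModule)).
  intros z _. apply CR_cont. }
apply continuous_ext with (fun x => ker_k K x * RInt g 0 x).
{ intros z. symmetry. transitivity (RInt (fun t => scal (ker_k K z) (g t)) 0 z).
  - apply RInt_ext. intros t _. unfold kernel, g, scal. simpl.
    unfold mult. simpl. ring.
  - apply (RInt_scal (V := R_CompleteNormedModule)). apply Hg. }
apply (continuous_mult (ker_k K) (fun x => RInt g 0 x)).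
- apply CR_cont.
- apply (ex_derive_continuous (V := R_NormedModule)).
  exists (g x). apply (is_derive_RInt (V := R_NormedModule) g _ 0).
  + exists (mkposreal 1 Rlt_0_1). intros z _.
    apply (RInt_correct (V := R_CompleteNormedModule)), Hg.
  + apply CR_cont.
Qed.

Definition volterra (K : separable_kernel) (f : CR) : CR :=
  mkCR (volterra_continuous K f).

Definition tau (K : separable_kernel) : CR :=
  CR_mul (ker_k K) (CR_const (/ ker_k K 0)).

Lemma tau_neq0 (K : separable_kernel) (x : R) : tau K x <> 0.
Proof.
apply Rmult_integral_contrapositive_currified.
- apply ker_k_neq0.
- apply Rinv_neq_0_compat, ker_k_neq0.
Qed.

Definition tau_inv (K : separable_kernel) : CR := CR_inv (tau K) (@tau_neq0 K).

(* [V] is the set of unknown functions.  A possibly unknown element of C(R) is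
   an element of C(R) depending on the values given to the unknowns; a known
   one is a constant map. *)
Definition assignment (V : Type) := V -> CR.
Definition label (V : Type) := assignment V -> CR.

Definition label_scale (V : Type) (f : CR) (a : label V) : label V :=
  fun y => CR_mul f (a y).

(* The children are listed, each with the label of the edge leading to it.  The
   order of the list carries no meaning: every construction below is insensitive
   to it or allows an arbitrary reordering. *)
Inductive tree (Omega V : Type) : Type :=
| Node : label V -> list (Omega * tree Omega V) -> tree Omega V.

Definition children (Omega V : Type) (T : tree Omega V) :
    list (Omega * tree Omega V) :=
  match T with Node _ c => c end.

(* The list stands for the formal sum of its members. *)
Definition forest (Omega V : Type) := list (tree Omega V).

(* A vertex is addressed by the positions of the children met on the path from
   the root to it. *)
Definition address := list nat.

Definition height (v : address) : nat := length v.

Fixpoint subtree (Omega V : Type) (T : tree Omega V) (v : address) {struct v} :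
    option (tree Omega V) :=
  match v with
  | [] => Some T
  | i :: v' =>
      match nth_error (children T) i with
      | Some (_, U) => subtree U v'
      | None => None
      end
  end.

Fixpoint modify_nth (A : Type) (f : A -> A) (i : nat) (l : list A) : list A :=
  match l, i with
  | [], _ => []
  | a :: l', O => f a :: l'
  | a :: l', S j => a :: modify_nth f j l'
  end.

(* [T] with its subtree at [v] replaced by [U]. *)
Fixpoint graft (Omega V : Type) (T : tree Omega V) (v : address)
    (U : tree Omega V) {struct v} : tree Omega V :=
  match v with
  | [] => U
  | i :: v' =>
      match T with
      | Node a c =>
          Node a (modify_nth (fun e => (fst e, graft (snd e) v' U)) i c)
      end
  end.

Definition branching_point (Omega V : Type) (T : tree Omega V) (v : address) :
    Prop :=
  exists U, subtree T v = Some U /\ (2 <= length (children U))%nat.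

Definition max_branching_point (Omega V : Type) (T : tree Omega V)
    (v : address) : Prop :=
  branching_point T v /\
  forall w, branching_point T w -> (height w <= height v)%nat.

Definition has_branching (Omega V : Type) (F : forest Omega V) : Prop :=
  exists T v, In T F /\ branching_point T v.

Fixpoint tree_poly (Omega V : Type) (K : Omega -> separable_kernel)
    (T : tree Omega V) (y : assignment V) {struct T} : CR :=
  match T with
  | Node a c =>
      CR_mul (a y)
        (fold_right CR_mul (CR_const 1)
           (map (fun e => volterra (K (fst e)) (tree_poly K (snd e) y)) c))
  end.

Definition forest_poly (Omega V : Type) (K : Omega -> separable_kernel)
    (F : forest Omega V) (y : assignment V) : CR :=
  fold_right CR_add (CR_const 0) (map (fun T => tree_poly K T y) F).

Definition solution (Omega V : Type) (K : Omega -> separable_kernel)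
    (F : forest Omega V) (y : assignment V) : Prop :=
  forall x, forest_poly K F y x = 0.

Definition equivalent (Omega V : Type) (K : Omega -> separable_kernel)
    (F F' : forest Omega V) : Prop :=
  forall y, solution K F y <-> solution K F' y.

(* The permutation is the arbitrary numbering of the children of the branching
   point.  When that vertex has maximal height among the branching points, the
   subtrees at its children are chains, so [c1] (resp. [c2]) is empty or holds
   just the edge to the second vertex of the first (resp. second) chain. *)
Inductive split_branching (Omega V : Type) (K : Omega -> separable_kernel) :
    tree Omega V -> tree Omega V -> tree Omega V -> Prop :=
| Split : forall x c al1 f1 c1 al2 f2 c2 rest,
    Permutation c ((al1, Node f1 c1) :: (al2, Node f2 c2) :: rest) ->
    split_branching K (Node x c)
      (Node (label_scale (tau (K al2)) x)
         ((al1, Node (label_scale (tau_inv (K al2)) f1)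
                  (c1 ++ [(al2, Node f2 c2)])) :: rest))
      (Node (label_scale (tau (K al1)) x)
         ((al2, Node (label_scale (tau_inv (K al1)) f2)
                  ((al1, Node f1 c1) :: c2)) :: rest)).

(* One pass through the loop, for any of the allowed choices. *)
Inductive step (Omega V : Type) (K : Omega -> separable_kernel) :
    forest Omega V -> forest Omega V -> Prop :=
| Step : forall F1 T F2 v U U1 U2,
    max_branching_point T v ->
    subtree T v = Some U ->
    split_branching K U U1 U2 ->
    step K (F1 ++ T :: F2) (F1 ++ graft T v U1 :: graft T v U2 :: F2).

(* Whatever choices are made, the algorithm started on [F] never gets stuck and
   stops after finitely many passes. *)
Inductive terminates (Omega V : Type) (K : Omega -> separable_kernel)
    (F : forest Omega V) : Prop :=
| terminates_stop : ~ has_branching F -> terminates K F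
| terminates_step :
    (exists G, step K F G) ->
    (forall G, step K F G -> terminates K G) ->
    terminates K F.

(* Some run of the algorithm started on the first forest stops and returns the
   second. *)
Inductive outputs (Omega V : Type) (K : Omega -> separable_kernel) :
    forest Omega V -> forest Omega V -> Prop :=
| outputs_stop : forall F, ~ has_branching F -> outputs K F F
| outputs_step : forall F G F',
    step K F G -> outputs K G F' -> outputs K F F'.

(* Main.v *)
(** Integration by parts gives the weighted Rota-Baxter identity
    [P1 f * P2 g = tau2 * P1 (f / tau2 * P2 g) + tau1 * P2 (g / tau1 * P1 f)],
    so [p_T = p_T1 + p_T2] in every pass and the solution set is unchanged.

    For termination, let [w T] be the number of linear extensions of the tree
    order of [T], that is, [n! / prod_v |T(v)|] by the hook length formula.  In a
    linear extension one of the first two children of the branching point comes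
    before the other, so [w T = w T1 + w T2]; on hook products this is
    [1/(s1 s2) = 1/((s1+s2) s2) + 1/((s1+s2) s1)].  The total weight of the forest
    is therefore invariant.  Every tree has weight at least 1 and every pass adds
    one tree, so the number of passes is bounded. *)

Require Import Defs.
From Stdlib Require Import Reals List.
From Coquelicot Require Import Coquelicot.
From Stdlib Require Import Factorial Wf_nat Lra Lia Permutation Classical.
Import ListNotations.
Open Scope R_scope.

(** * Finite products and sums over lists *)

Definition Rprod (l : list R) : R := fold_right Rmult 1 l.

Lemma Rprod_cons (a : R) (l : list R) : Rprod (a :: l) = a * Rprod l.
Proof. reflexivity. Qed.

Lemma Rprod_app (l l' : list R) : Rprod (l ++ l') = Rprod l * Rprod l'.
Proof.
induction l as [|a l IH]; simpl; [|rewrite IH]; ring.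
Qed.

Lemma Rprod_permutation (l l' : list R) :
  Permutation l l' -> Rprod l = Rprod l'.
Proof.
induction 1; simpl; [reflexivity| |ring|congruence].
now rewrite IHPermutation.
Qed.

(** A product is additive in each factor while the others stay fixed. This serves both hook products
    and integral polynomials. *)
Lemma Rprod_modify_nth (A : Type) (g : A -> R) (f1 f2 : A -> A) (i : nat)
    (l : list A) (a : A) :
  nth_error l i = Some a -> g a = g (f1 a) + g (f2 a) ->
  Rprod (map g l) =
  Rprod (map g (modify_nth f1 i l)) + Rprod (map g (modify_nth f2 i l)).
Proof.
revert i; induction l as [|b l IH]; intros [|i] Ha Hg; try discriminate; simpl.
- injection Ha as ->. rewrite Hg. ring.
- rewrite (IH i Ha Hg). ring.
Qed.

Lemma Permutation_nat_sum (l l' : list nat) :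
  Permutation l l' -> list_sum l = list_sum l'.
Proof.
induction 1; simpl in *; lia.
Qed.

Lemma list_sum_modify_nth (A : Type) (g : A -> nat) (f : A -> A) (i : nat)
    (l : list A) (a : A) :
  nth_error l i = Some a -> g (f a) = g a ->
  list_sum (map g (modify_nth f i l)) = list_sum (map g l).
Proof.
revert i; induction l as [|b l IH]; intros [|i] Ha Hg; try discriminate; simpl.
- injection Ha as ->. now rewrite Hg.
- now rewrite (IH i Ha Hg).
Qed.

Lemma list_sum_nth_error (l : list nat) (i n : nat) :
  nth_error l i = Some n -> (n <= list_sum l)%nat.
Proof.
revert i; induction l as [|b l IH]; intros [|i] Hn; try discriminate; simpl.
- injection Hn as ->. lia.
- specialize (IH i Hn). simpl in IH. lia.
Qed.

(** The quotient of the two sides is a binomial coefficient. *)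
Lemma fact_mult_le (a b : nat) : (fact a * fact b <= fact (a + b))%nat.
Proof.
induction a as [|a IH]; simpl; [lia|].
nia.
Qed.

(** * Integration by parts and Volterra operators *)

Lemma CR_ex_RInt (f : CR) (a b : R) : ex_RInt f a b.
Proof.
apply (ex_RInt_continuous (V := R_CompleteNormedModule)).
intros z _. apply CR_cont.
Qed.

Lemma CR_is_derive_RInt (f : CR) (x : R) :
  is_derive (fun x => RInt f 0 x) x (f x).
Proof.
apply (is_derive_RInt (V := R_NormedModule) f _ 0).
- exists (mkposreal 1 Rlt_0_1). intros z _.
  apply (RInt_correct (V := R_CompleteNormedModule)), CR_ex_RInt.
- apply CR_cont.
Qed.

(** Product rule and fundamental theorem of calculus; the boundary term at 0 vanishes. *)
Lemma RInt_mult_RInt (f g : CR) (x : R) :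
  RInt f 0 x * RInt g 0 x =
  RInt (fun t => f t * RInt g 0 t) 0 x + RInt (fun t => g t * RInt f 0 t) 0 x.
Proof.
assert (HC : forall (u : CR) t, continuous (fun x => RInt u 0 x) t).
{ intros u t. apply (ex_derive_continuous (V := R_NormedModule)).
  exists (u t). apply CR_is_derive_RInt. }
set (p := fun t => f t * RInt g 0 t).
set (q := fun t => g t * RInt f 0 t).
assert (Hp : forall t, continuous p t).
{ intros t. apply (continuous_mult f); [apply CR_cont|apply HC]. }
assert (Hq : forall t, continuous q t).
{ intros t. apply (continuous_mult g); [apply CR_cont|apply HC]. }
assert (Hsum : is_RInt (fun t => p t + q t) 0 x
  (RInt f 0 x * RInt g 0 x - RInt f 0 0 * RInt g 0 0)).
{ apply (is_RInt_derive (V := R_CompleteNormedModule)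
           (fun t => RInt f 0 t * RInt g 0 t) (fun t => p t + q t)).
  - intros t _. unfold p, q.
    replace (f t * RInt g 0 t + g t * RInt f 0 t)
      with (f t * RInt g 0 t + RInt f 0 t * g t) by ring.
    apply (is_derive_mult (fun x => RInt f 0 x) (fun x => RInt g 0 x));
      try apply CR_is_derive_RInt.
    intros; apply Rmult_comm.
  - intros t _. apply (continuous_plus p q); [apply Hp|apply Hq]. }
apply (is_RInt_unique (V := R_CompleteNormedModule)) in Hsum.
rewrite (RInt_point (V := R_CompleteNormedModule)) in Hsum.
unfold zero in Hsum; simpl in Hsum.
rewrite Rmult_0_l, Rminus_0_r in Hsum. rewrite <- Hsum.
apply (RInt_plus (V := R_CompleteNormedModule) p q);
  apply (ex_RInt_continuous (V := R_CompleteNormedModule)); auto.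
Qed.

Lemma volterra_eq (K : separable_kernel) (f : CR) (x : R) :
  volterra K f x = ker_k K x * RInt (CR_mul (ker_h K) f) 0 x.
Proof.
transitivity (RInt (fun t => scal (ker_k K x) (CR_mul (ker_h K) f t)) 0 x).
- apply RInt_ext. intros t _. unfold kernel, scal; simpl.
  unfold mult; simpl. ring.
- apply (RInt_scal (V := R_CompleteNormedModule)), CR_ex_RInt.
Qed.

(** The sum is taken pointwise because elements of [CR] carry continuity proofs, which makes
    equality in [CR] awkward. *)
Lemma volterra_plus (K : separable_kernel) (f g h : CR) :
  (forall t, h t = f t + g t) ->
  forall x, volterra K h x = volterra K f x + volterra K g x.
Proof.
intros H x. rewrite !volterra_eq, <- Rmult_plus_distr_l. f_equal.
rewrite <- (RInt_plus (V := R_CompleteNormedModule)) by apply CR_ex_RInt.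
apply RInt_ext. intros t _. unfold plus; simpl. rewrite H. apply Rmult_plus_distr_l.
Qed.

(** Weighted Rota-Baxter identity. The arguments [f'] and [g'] are specified pointwise so that
    polynomials of trees can be substituted for them. *)
Lemma volterra_mult (K1 K2 : separable_kernel) (f g f' g' : CR) :
  (forall t, f' t = tau_inv K2 t * f t * volterra K2 g t) ->
  (forall t, g' t = tau_inv K1 t * g t * volterra K1 f t) ->
  forall x, volterra K1 f x * volterra K2 g x =
    tau K2 x * volterra K1 f' x + tau K1 x * volterra K2 g' x.
Proof.
(* Swapping the kernels exchanges the two terms on the right, so one computation handles both. *)
assert (aux : forall (L1 L2 : separable_kernel) (u v u' : CR),
  (forall t, u' t = tau_inv L2 t * u t * volterra L2 v t) ->
  forall x, tau L2 x * volterra L1 u' x = ker_k L1 x * ker_k L2 x *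
    RInt (fun t => CR_mul (ker_h L1) u t * RInt (CR_mul (ker_h L2) v) 0 t) 0 x).
{ intros L1 L2 u v u' Hu x. rewrite volterra_eq.
  (* Under the integral, [tau_inv L2 t * ker_k L2 t] is the constant [ker_k L2 0]. *)
  assert (E : RInt (fun t => CR_mul (ker_h L1) u t *
                RInt (CR_mul (ker_h L2) v) 0 t) 0 x =
              / ker_k L2 0 * RInt (CR_mul (ker_h L1) u') 0 x).
  { rewrite <- (RInt_scal (V := R_CompleteNormedModule)
                  (CR_mul (ker_h L1) u')) by apply CR_ex_RInt.
    apply RInt_ext. intros t _. unfold scal; simpl. unfold mult; simpl.
    rewrite Hu, volterra_eq. set (r := RInt _ 0 t). simpl. unfold mult; simpl.
    field. split; apply ker_k_neq0. }
  rewrite E. change (tau L2 x) with (ker_k L2 x * / ker_k L2 0). ring. }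
intros Hf Hg x. rewrite (aux K1 K2 f g f' Hf x), (aux K2 K1 g f g' Hg x).
rewrite !volterra_eq.
replace (ker_k K2 x * ker_k K1 x) with (ker_k K1 x * ker_k K2 x) by ring.
rewrite <- Rmult_plus_distr_l, <- RInt_mult_RInt. ring.
Qed.

(** * Sizes and weights of trees *)

Section Trees.

Variables Omega V : Type.
Implicit Types (T U : tree Omega V) (F G : forest Omega V).

(** The automatic principle gives no hypothesis for subtrees nested in the list of children. *)
Lemma tree_children_ind (P : tree Omega V -> Prop) :
  (forall a c, List.Forall (fun e => P (snd e)) c -> P (Node a c)) ->
  forall T, P T.
Proof.
intros H. fix IH 1. intros [a c]. apply H.
induction c as [|[w T] c IHc]; constructor; [apply IH|apply IHc].
Qed.

Fixpoint size T : nat :=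
  match T with Node _ c => S (list_sum (map (fun e => size (snd e)) c)) end.

(** Reciprocal of the hook product, real-valued to avoid divisibility questions. *)
Fixpoint inv_hook T : R :=
  match T with
  | Node _ c => / INR (size T) * Rprod (map (fun e => inv_hook (snd e)) c)
  end.

Definition weight T : R := INR (fact (size T)) * inv_hook T.

Definition forest_weight F : R := fold_right Rplus 0 (map weight F).

Lemma size_neq0 T : INR (size T) <> 0.
Proof.
destruct T. simpl size. now apply not_0_INR.
Qed.

(** The hook of the root cancels the top factor of the factorial, and the factorial of a sum is at
    least the product of the factorials. Hence the weight is at least the product of the weights of
    the children. *)
Lemma weight_ge1 T : 1 <= weight T.
Proof.
induction T as [a c IH] using tree_children_ind. unfold weight.
cbn [inv_hook]. change (size (Node a c))
  with (S (list_sum (map (fun e => size (snd e)) c))).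
rewrite fact_simpl, mult_INR.
match goal with |- _ <= INR (S ?n) * ?f * (_ * ?p) =>
  replace (INR (S n) * f * (/ INR (S n) * p)) with (f * p)
    by (field; now apply not_0_INR)
end.
induction c as [|[w T] c IHc]; cbn [map list_sum fold_right snd Rprod].
- simpl. lra.
- inversion IH as [|? ? HT Hc]; subst. specialize (IHc Hc). simpl in HT.
  unfold weight in HT.
  set (n := size T) in *. set (p := inv_hook T) in *.
  fold (list_sum (map (fun e => size (snd e)) c)) in *.
  set (m := list_sum _) in *.
  fold (Rprod (map (fun e => inv_hook (snd e)) c)).
  set (r := Rprod _) in *.
  assert (Hnm : INR (fact n) * INR (fact m) <= INR (fact (n + m))).
  { rewrite <- mult_INR. apply le_INR, fact_mult_le. }
  assert (Hn := INR_fact_lt_0 n). assert (Hm := INR_fact_lt_0 m).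
  (* Both products with a positive factorial are at least 1. *)
  assert (0 < p) by nra. assert (0 < r) by nra.
  assert (0 < p * r) by nra.
  apply Rle_trans with ((INR (fact n) * p) * (INR (fact m) * r)); [nra|].
  replace (INR (fact n) * p * (INR (fact m) * r))
    with (INR (fact n) * INR (fact m) * (p * r)) by ring.
  apply Rmult_le_compat_r; lra.
Qed.

Lemma length_le_forest_weight F : INR (length F) <= forest_weight F.
Proof.
induction F as [|T F IH]; cbn [length]; [apply Rle_refl|].
rewrite S_INR. unfold forest_weight in *; simpl.
assert (H := weight_ge1 T). lra.
Qed.

Lemma subtree_size T v U :
  subtree T v = Some U -> (height v + size U <= size T)%nat.
Proof.
revert T; induction v as [|i v IH]; intros [a c] H; simpl in H.
- injection H as <-. simpl. lia.
- destruct (nth_error c i) as [[w T']|] eqn:E; [|discriminate].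
  apply IH in H. simpl. unfold height in *.
  apply (map_nth_error (fun e => size (snd e))) in E. simpl in E.
  apply list_sum_nth_error in E. simpl in *. lia.
Qed.

Lemma size_graft T v U U' :
  subtree T v = Some U -> size U' = size U -> size (graft T v U') = size T.
Proof.
revert T; induction v as [|i v IH]; intros [a c] H HU; simpl in H.
- injection H as <-. exact HU.
- destruct (nth_error c i) as [[w T']|] eqn:E; [|discriminate].
  simpl. f_equal. apply list_sum_modify_nth with (w, T'); [exact E|].
  simpl. now apply IH.
Qed.

(** Equal sizes leave the hooks of all ancestors of [v] unchanged, so additivity passes down the
    path one product at a time. *)
Lemma inv_hook_graft T v U U1 U2 :
  subtree T v = Some U -> size U1 = size U -> size U2 = size U ->
  inv_hook U = inv_hook U1 + inv_hook U2 ->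
  inv_hook T = inv_hook (graft T v U1) + inv_hook (graft T v U2).
Proof.
intros H H1 H2 HU.
revert T H; induction v as [|i v IH]; intros T H.
- simpl in *. injection H as ->. exact HU.
- assert (S1 := size_graft T (i :: v) U U1 H H1).
  assert (S2 := size_graft T (i :: v) U U2 H H2).
  destruct T as [a c]. simpl in H.
  destruct (nth_error c i) as [[w T']|] eqn:E; [|discriminate].
  cbn [graft] in *. cbn [inv_hook]. rewrite S1, S2, <- Rmult_plus_distr_l.
  f_equal. apply Rprod_modify_nth with (w, T'); [exact E|].
  simpl. now apply IH.
Qed.

(** * Integral polynomials under grafting and splitting *)

Lemma label_scale_eq (f : CR) (a : label V) (y : assignment V) (x : R) :
  label_scale f a y x = f x * a y x.
Proof. reflexivity. Qed.

Variable K : Omega -> separable_kernel.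

Lemma tree_poly_node (a : label V) (c : list (Omega * tree Omega V))
    (y : assignment V) (x : R) :
  tree_poly K (Node a c) y x =
  a y x * Rprod (map (fun e => volterra (K (fst e)) (tree_poly K (snd e) y) x) c).
Proof.
assert (H : forall l : list CR, fold_right CR_mul (CR_const 1) l x =
              Rprod (map (fun f : CR => f x) l)).
{ induction l as [|f l IH]; simpl; [reflexivity|now rewrite IH]. }
apply (f_equal (Rmult (a y x))). rewrite H, map_map. reflexivity.
Qed.

Lemma forest_poly_cons T F (y : assignment V) (x : R) :
  forest_poly K (T :: F) y x = tree_poly K T y x + forest_poly K F y x.
Proof. reflexivity. Qed.

(** Volterra operators are additive and products are additive in each factor, so the polynomial
    depends additively on the subtree at [v]. *)
Lemma tree_poly_graft T v U U1 U2 (y : assignment V) :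
  subtree T v = Some U ->
  (forall x, tree_poly K U y x = tree_poly K U1 y x + tree_poly K U2 y x) ->
  forall x, tree_poly K T y x =
    tree_poly K (graft T v U1) y x + tree_poly K (graft T v U2) y x.
Proof.
intros H HU.
revert T H; induction v as [|i v IH]; intros [a c] H x; simpl in H.
- injection H as <-. apply HU.
- destruct (nth_error c i) as [[w T']|] eqn:E; [|discriminate].
  cbn [graft]. rewrite !tree_poly_node, <- Rmult_plus_distr_l. f_equal.
  apply (Rprod_modify_nth _
    (fun e => volterra (K (fst e)) (tree_poly K (snd e) y) x)) with (w, T').
  + exact E.
  + apply volterra_plus. now apply IH.
Qed.

Lemma split_branching_poly U U1 U2 (y : assignment V) :
  split_branching K U U1 U2 ->
  forall x, tree_poly K U y x = tree_poly K U1 y x + tree_poly K U2 y x.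
Proof.
destruct 1 as [a c al1 f1 c1 al2 f2 c2 rest Hc]. intros x.
rewrite !tree_poly_node.
rewrite (Rprod_permutation _ _ (Permutation_map _ Hc)).
rewrite !map_cons, !Rprod_cons. cbn [fst snd].
set (r := Rprod _). rewrite <- !Rmult_assoc.
(* [p] and [q] come from the two chosen children; [r] collects the others, common to all three
   trees. *)
match goal with |- ?ax * ?p * ?q * _ = _ * ?p1 * _ + _ * ?p2 * _ =>
  assert (E : p * q = tau (K al2) x * p1 + tau (K al1) x * p2)
end.
{ apply volterra_mult; intros t; rewrite !tree_poly_node, label_scale_eq;
    rewrite ?map_app, ?Rprod_app, map_cons, Rprod_cons; cbn [fst snd]; [|ring].
  change (Rprod (map _ [])) with 1. ring. }
rewrite (Rmult_assoc (a y x)), E, !label_scale_eq. ring.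
Qed.

(** * Sizes and hook products under splitting *)

Lemma split_branching_size U U1 U2 :
  split_branching K U U1 U2 -> size U1 = size U /\ size U2 = size U.
Proof.
destruct 1 as [a c al1 f1 c1 al2 f2 c2 rest Hc]. simpl.
rewrite (Permutation_nat_sum _ _ (Permutation_map _ Hc)), map_app, list_sum_app.
simpl. lia.
Qed.

(** The hook of the root and the remaining children are common factors; what is left is the partial
    fraction identity in [s1] and [s2]. *)
Lemma split_branching_inv_hook U U1 U2 :
  split_branching K U U1 U2 -> inv_hook U = inv_hook U1 + inv_hook U2.
Proof.
intros H. destruct (split_branching_size _ _ _ H) as [S1 S2].
destruct H as [a c al1 f1 c1 al2 f2 c2 rest Hc].
cbn [inv_hook]. rewrite S1, S2, <- Rmult_plus_distr_l. f_equal.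
rewrite (Rprod_permutation _ _ (Permutation_map _ Hc)).
rewrite !map_cons, !Rprod_cons. cbn [snd].
rewrite <- Rmult_assoc, <- Rmult_plus_distr_r. f_equal.
cbn [inv_hook]. rewrite map_app, Rprod_app, !map_cons, !Rprod_cons.
change (Rprod (map _ [])) with 1. cbn [snd inv_hook].
set (s1 := size (Node f1 c1)). set (s2 := size (Node f2 c2)).
set (p1 := Rprod _). set (p2 := Rprod _).
(* In either new tree, the child now carrying both subtrees has hook [s1 + s2]. *)
match goal with |- context [size (Node (label_scale (tau_inv (K al2)) f1) ?l)] =>
  replace (size (Node (label_scale (tau_inv (K al2)) f1) l)) with (s1 + s2)%nat
    by (unfold s1, s2; simpl; rewrite map_app, list_sum_app; simpl; lia)
end.
match goal with |- context [size (Node (label_scale (tau_inv (K al1)) f2) ?l)] =>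
  replace (size (Node (label_scale (tau_inv (K al1)) f2) l)) with (s1 + s2)%nat
    by (unfold s1, s2; simpl; lia)
end.
assert (H12 : INR (s1 + s2) <> 0) by now apply not_0_INR.
assert (H1 : INR s1 <> 0) by apply size_neq0.
assert (H2 : INR s2 <> 0) by apply size_neq0.
rewrite plus_INR in *. field. auto.
Qed.

(** * Existence and invariants of a pass *)

Lemma split_branching_exists U :
  (2 <= length (children U))%nat -> exists U1 U2, split_branching K U U1 U2.
Proof.
destruct U as [x [|[al1 [f1 c1]] [|[al2 [f2 c2]] rest]]]; simpl; try lia.
intros _. eexists. eexists. apply Split. apply Permutation_refl.
Qed.

(** Heights are bounded by the size of the tree, so passing to ever higher branching points must
    stop. *)
Lemma max_branching_point_exists T v :
  branching_point T v -> exists w, max_branching_point T w.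
Proof.
remember (size T - height v)%nat as n eqn:Hn.
revert v Hn; induction n as [n IH] using lt_wf_ind; intros v Hn Hv.
destruct (classic (exists w, branching_point T w /\ (height v < height w)%nat))
  as [[w [Hw Hvw]]|Hmax].
- apply IH with (size T - height w)%nat w; auto.
  destruct Hw as [U [HU _]]. apply subtree_size in HU.
  destruct U. simpl in HU. lia.
- exists v. split; [exact Hv|]. intros w Hw.
  apply Nat.nlt_ge. intros Hvw. apply Hmax. eauto.
Qed.

Lemma step_exists F : has_branching F -> exists G, step K F G.
Proof.
intros [T [v [HT Hv]]].
destruct (max_branching_point_exists T v Hv) as [w Hw].
destruct (in_split _ _ HT) as [F1 [F2 ->]].
destruct (proj1 Hw) as [U [HU Hlen]].
destruct (split_branching_exists U Hlen) as [U1 [U2 HS]].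
eexists. eapply Step; eauto.
Qed.

Lemma step_length F G : step K F G -> length G = S (length F).
Proof.
destruct 1. rewrite !length_app. simpl. lia.
Qed.

Lemma step_weight F G : step K F G -> forest_weight G = forest_weight F.
Proof.
destruct 1 as [F1 T F2 v U U1 U2 Hv HU HS].
destruct (split_branching_size _ _ _ HS) as [S1 S2].
assert (E := inv_hook_graft T v U U1 U2 HU S1 S2 (split_branching_inv_hook _ _ _ HS)).
(* The three trees have the same size, hence the same factorial. *)
assert (EW : weight T = weight (graft T v U1) + weight (graft T v U2)).
{ unfold weight.
  rewrite (size_graft _ _ _ _ HU S1), (size_graft _ _ _ _ HU S2), E. ring. }
unfold forest_weight.
induction F1 as [|T1 F1 IH]; simpl; [rewrite EW; ring|now rewrite IH].
Qed.

(** The integral polynomial itself is preserved, at every assignment and every point. *)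
Lemma step_equivalent F G : step K F G -> equivalent K F G.
Proof.
destruct 1 as [F1 T F2 v U U1 U2 Hv HU HS]. intros y.
assert (E : forall x, forest_poly K (F1 ++ T :: F2) y x =
  forest_poly K (F1 ++ graft T v U1 :: graft T v U2 :: F2) y x).
{ intros x.
  assert (ET := tree_poly_graft T v U U1 U2 y HU
                  (split_branching_poly _ _ _ y HS) x).
  induction F1 as [|T1 F1 IH]; cbn [app]; rewrite !forest_poly_cons.
  - rewrite ET. ring.
  - now rewrite IH. }
split; intros H x; [rewrite <- E|rewrite E]; apply H.
Qed.

(** Induction on [N - length F]: a pass lengthens the forest but keeps its weight, which bounds the
    length. *)
Lemma terminates_of_weight (N : nat) F :
  forest_weight F <= INR N -> terminates K F.
Proof.
remember (N - length F)%nat as n eqn:Hn.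
revert F Hn; induction n as [n IH] using lt_wf_ind; intros F Hn HF.
destruct (classic (has_branching F)) as [Hb|Hb].
2: now apply terminates_stop.
apply terminates_step; [now apply step_exists|].
intros G HG.
assert (HW := step_weight _ _ HG). assert (HL := step_length _ _ HG).
(* Without this bound the truncated subtraction could stay at 0 instead of decreasing. *)
assert (length G <= N)%nat.
{ apply INR_le. assert (H := length_le_forest_weight G). lra. }
apply IH with (N - length G)%nat; lia || lra.
Qed.

Lemma outputs_spec F F' :
  outputs K F F' -> ~ has_branching F' /\ equivalent K F F'.
Proof.
induction 1 as [F Hb|F G F' HS _ [Hb HE]].
- split; [exact Hb|]. intros y. apply iff_refl.
- split; [exact Hb|]. intros y.
  exact (iff_trans (step_equivalent _ _ HS y) (HE y)).
Qed.

End Trees.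

Theorem theorem4 (Omega : Type) (K : Omega -> separable_kernel) (V : Type)
    (F0 : forest Omega V) :
  terminates K F0 /\
  (forall F' : forest Omega V,
     outputs K F0 F' -> ~ has_branching F' /\ equivalent K F0 F').
Proof.
split; [|apply outputs_spec].
destruct (INR_unbounded (forest_weight _ _ F0)) as [N HN].
apply terminates_of_weight with N. lra.
Qed.
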